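(* Let the flux $f$ be either convex or concave, and suppose that the Rankine-Hugoniot relation $f(u_\ell)=f(u_r)$ and the entropy inequalities $f'(u_r)<0<f'(u_\ell)$ hold. Then under the condition $\max(\alpha_\ell,|\alpha_r|)<1$, the operator $\mathscr{L}$ has no spectrum in $\{\zeta\in\mathbb{C} : |\zeta|\ge 1\}\setminus\{1\}$. Moreover, $1$ is an eigenvalue of $\mathscr{L}$ in $\ell^q(\mathbb{Z};\mathbb{C})$ for any $q\in[1,+\infty]$.
   Context: Let $f\in\mathscr{C}^\infty(\mathbb{R};\mathbb{R})$ and consider the scalar conservation law $\partial_t u+\partial_x f(u)=0$, $x\in\mathbb{R}$. Let $u_\ell,u_r\in\mathbb{R}$ and consider the step function $u(t,x)=u_\ell$ for $x<0$, $u(t,x)=u_r$ for $x>0$ (a weak solution when $f(u_\ell)=f(u_r)$). Let $\lambda>0$ (the ratio $\Delta t/\Delta x$) and set $\alpha_\ell:=\lambda f'(u_\ell)$, $\alpha_r:=\lambda f'(u_r)$, $\alpha_m:=\lambda f'\big(\frac{u_\ell+u_r}{2}\big)$. The operator $\mathscr{L}$ is the linearization of the Lax-Wendroff scheme about the stationary discrete shock $\overline{u}_j=u_\ell$ ($j\le 0$), $\overline{u}_j=u_r$ ($j\ge1$). It is the bounded linear operator on $\ell^q(\mathbb{Z};\mathbb{C})$, $1\le q\le+\infty$, defined by $$(\mathscr{L}\mathbf{w})_j:=\begin{cases} w_j-\frac{\alpha_r}{2}(w_{j+1}-w_{j-1})+\frac{\alpha_r^2}{2}(w_{j+1}-2w_j+w_{j-1}),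 & j\ge2,\\ w_j-\frac{\alpha_\ell}{2}(w_{j+1}-w_{j-1})+\frac{\alpha_\ell^2}{2}(w_{j+1}-2w_j+w_{j-1}), & j\le-1,\\ w_0-\frac12(\alpha_r w_1-\alpha_\ell w_{-1})+\frac12\big(\alpha_r\alpha_m w_1-\alpha_\ell(\alpha_\ell+\alpha_m)w_0+\alpha_\ell^2 w_{-1}\big), & j=0,\\ w_1-\frac12(\alpha_r w_2-\alpha_\ell w_0)+\frac12\big(\alpha_r^2 w_2-\alpha_r(\alpha_r+\alpha_m)w_1+\alpha_\ell\alpha_m w_0\big), & j=1.\end{cases}$$ The spectrum is understood for $\mathscr{L}$ acting on $\ell^q(\mathbb{Z};\mathbb{C})$, for any $q\in[1,+\infty]$. *)

(* Defs.v *)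
From HB Require Import structures.
From mathcomp Require Import all_boot all_order all_algebra.
From mathcomp Require Import all_classical all_reals all_analysis.
From mathcomp Require Import complex zify ring.

Set Implicit Arguments.
Unset Strict Implicit.
Unset Printing Implicit Defensive.
Import Order.TTheory GRing.Theory Num.Theory.
Import numFieldNormedType.Exports.

Local Open Scope classical_set_scope.
Local Open Scope ring_scope.
Local Open Scope complex_scope.
Local Open Scope card_scope.

HB.instance Definition _ := isPointed.Build int 0.

HB.instance Definition _ := @isMeasurable.Build default_measure_display
  int (@discrete_measurable int) (@discrete_measurable0 int)
  (@discrete_measurableC int) (@discrete_measurableU int).

(* For q = +oo, Lnorm is an essential supremum; as only the empty set is null for
   the counting measure, it is the supremum of the moduli. *)
Definition lqnorm (R : realType) (q : \bar R) (w : int -> R[i]) : \bar R :=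
  Lnorm (@counting int R) q (fun j => (Normc.normc (w j))%:E).

Definition ell (R : realType) (q : \bar R) : set (int -> R[i]) :=
  [set w | (lqnorm q w < +oo)%E].

(* Operators on ell^q are represented by maps on all of int -> R[i], of which
   only the restriction to ell q is relevant. The last condition implies that
   T maps ell q into itself. *)
Definition bounded_operator (R : realType) (q : \bar R)
    (T : (int -> R[i]) -> (int -> R[i])) : Prop :=
  (forall (a : R[i]) (u v : int -> R[i]), ell q u -> ell q v ->
     T (fun j => a * u j + v j) = (fun j => a * T u j + T v j)) /\
  (exists M : R, forall w, ell q w -> (lqnorm q (T w) <= M%:E * lqnorm q w)%E).

Definition resolvent_set (R : realType) (q : \bar R)
    (T : (int -> R[i]) -> (int -> R[i])) : set R[i] :=
  [set z | exists2 S : (int -> R[i]) -> (int -> R[i]), bounded_operator q S &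
     forall w, ell q w ->
       S (fun j => z * w j - T w j) = w /\
       (fun j => z * S w j - T (S w) j) = w].

Definition spectrum (R : realType) (q : \bar R)
    (T : (int -> R[i]) -> (int -> R[i])) : set R[i] :=
  ~` resolvent_set q T.

Definition eigenvalue_in (R : realType) (q : \bar R)
    (T : (int -> R[i]) -> (int -> R[i])) (z : R[i]) : Prop :=
  exists w : int -> R[i],
    [/\ ell q w, w <> (fun=> 0) & T w = (fun j => z * w j)].

Definition lax_wendroff (R : realType) (al ar am : R)
    (w : int -> R[i]) (j : int) : R[i] :=
  if 2 <= j then
    w j - (ar / 2)%:C * (w (j + 1) - w (j - 1))
    + (ar ^+ 2 / 2)%:C * (w (j + 1) - 2 * w j + w (j - 1))
  else if j <= -1 then
    w j - (al / 2)%:C * (w (j + 1) - w (j - 1))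
    + (al ^+ 2 / 2)%:C * (w (j + 1) - 2 * w j + w (j - 1))
  else if j == 0 then
    w 0 - 2^-1 * (ar%:C * w 1 - al%:C * w (- 1))
    + 2^-1 * ((ar * am)%:C * w 1 - (al * (al + am))%:C * w 0
              + (al ^+ 2)%:C * w (- 1))
  else
    w 1 - 2^-1 * (ar%:C * w 2 - al%:C * w 0)
    + 2^-1 * ((ar ^+ 2)%:C * w 2 - (ar * (ar + am))%:C * w 1
              + (al * am)%:C * w 0).

Definition smooth (R : realType) (f : R -> R) : Prop :=
  forall (n : nat) (x : R), derivable (derive1n n f) x 1.

Lemma counting_shift (R : realType) (k : int) (A : set int) :
  counting ((fun j => j + k) @^-1` A) = counting A :> \bar R.
Proof.
pose B := (fun j : int => j + k) @^-1` A.
have eB : B #= A.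
  have <- : (fun j : int => j + k) @` B = A.
    rewrite image_preimage//; apply/seteqP; split=> // j _.
    by exists (j - k) => //; rewrite subrK.
  by apply: card_esym; apply: inj_card_eq => i j _ _ /addIr.
rewrite /counting -/B (eq_finite_set eB); case: ifPn => // /asboolP fA.
have fB : finite_set B by rewrite (eq_finite_set eB).
congr (_%:R%:E); apply/card_eq_fsetP.
rewrite fset_setK//; apply: card_eq_trans eB _.
by rewrite -[X in X #= _]fset_setK//; exact/card_eq_fsetP.
Qed.


Lemma le_Lnorm_counting (R : realType) (q : \bar R) (u v : int -> R) :
  (1 <= q)%E -> (forall j, `|u j| <= `|v j|) ->
  (Lnorm (@counting int R) q (EFin \o u) <=
   Lnorm (@counting int R) q (EFin \o v))%E.
Proof.
case: q => [r| |]//; rewrite unlock => q1 uv /=; last first.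
  case: ifPn => // _; apply: ess_sup_inf.le_ess_sup.
  by apply: aeW => j /=; rewrite lee_fin.
have r0 : 0 <= r by rewrite (le_trans ler01)// -lee_fin.
apply: gt0_ler_poweR; rewrite ?invr_ge0//.
- by rewrite in_itv /= leey andbT; apply: integral_ge0 => *; rewrite ?lee_fin ?powR_ge0 ?poweR_ge0.
- by rewrite in_itv /= leey andbT; apply: integral_ge0 => *; rewrite ?lee_fin ?powR_ge0 ?poweR_ge0.
apply: ge0_le_integral => // j _.
by rewrite lee_fin ge0_ler_powR// nnegrE.
Qed.

Lemma Lnorm_counting_nat (R : realType) (q : \bar R) (n : nat) (u : int -> R) :
  (1 <= q)%E ->
  (Lnorm (@counting int R) q (EFin \o (fun j => n%:R * u j)%R) <=
   n%:R%:E * Lnorm (@counting int R) q (EFin \o u))%E.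
Proof.
move=> q1; elim: n => [|n IH].
  rewrite mul0e (_ : EFin \o _ = cst 0%E); last first.
    by apply/funext => j /=; rewrite mul0r.
  by rewrite Lnorm0// gt_eqF// (lt_le_trans _ q1).
rewrite (_ : EFin \o _ = EFin \o ((fun j => n%:R * u j) \+ u)%R); last first.
  by apply/funext => j /=; rewrite -natr1 mulrDl mul1r.
apply: (le_trans (eminkowski _ _ _ q1)) => //.
by rewrite -natr1 EFinD ge0_muleDl// ?lee_fin// mul1e leeD2r.
Qed.

Lemma lqnorm_shift (R : realType) (q : \bar R) (k : int) (w : int -> R[i]) :
  (1 <= q)%E -> lqnorm q (fun j => w (j + k)) = lqnorm q w.
Proof.
case: q => [r| |]//; rewrite /lqnorm unlock => r1 /=; last first.
  case: ifPn => // _.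
  have sup_le k' (v : int -> R[i]) :
      (ess_sup_inf.ess_sup (@counting int R)
         (abse \o (fun j => (Normc.normc (v (j + k')%R))%:E)) <=
       ess_sup_inf.ess_sup (@counting int R)
         (abse \o (fun j => (Normc.normc (v j))%:E)))%E.
    apply/ess_sup_inf.ess_supP.
    have [N [mN N0 sN]] := @ess_sup_inf.ess_sup_ge _ _ _ (@counting int R)
      (abse \o (fun j => (Normc.normc (v j))%:E)).
    exists ((fun j => j + k') @^-1` N); split => //.
      by rewrite /= counting_shift.
    by move=> j /= Hj; apply: sN => /= H; apply: Hj; exact: H.
  apply/eqP; rewrite eq_le sup_le /=.
  have := sup_le (- k) (fun j => w (j + k)).
  suff -> : (fun j => (Normc.normc (w (j - k + k)))%:E) =
            (fun j => (Normc.normc (w j))%:E) by [].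
  by apply/funext => j; rewrite subrK.
congr (_ `^ _)%E.
rewrite -[LHS](@ge0_integral_pushforward _ _ _ _ R (fun j : int => j + k) _ counting setT 
    (fun j => (`| (Normc.normc (w j))%:E | `^ r)%E))//.
- apply: (eq_measure_integral (@counting int R)) => [|mphi A mA _]; first by [].
  exact: counting_shift.
- by move=> j _; exact: poweR_ge0.
Qed.

Lemma normc_comb (R : realType) (K a b c : R) (x y z : R[i]) :
  `|a| <= K -> `|b| <= K -> `|c| <= K ->
  Normc.normc (a%:C * x + b%:C * y + c%:C * z) <=
  K * (Normc.normc x + Normc.normc y + Normc.normc z).
Proof.
have nE (t : R[i]) : (Normc.normc t)%:C = `|t| by [].
have n0 (t : R[i]) : 0 <= Normc.normc t by case: t => t1 t2; exact: sqrtr_ge0.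
have nD (s t : R[i]) : Normc.normc (s + t) <= Normc.normc s + Normc.normc t.
  by rewrite -lecR rmorphD /= !nE ler_normD.
have nR (t : R) : Normc.normc t%:C = `|t|.
  by rewrite /= expr0n /= addr0 sqrtr_sqr.
move=> ha hb hc; apply: (le_trans (nD _ _)); apply: (le_trans (lerD (nD _ _) (lexx _))).
rewrite !Normc.normcM !nR !mulrDr; apply: lerD; last exact: ler_wpM2r.
by apply: lerD; exact: ler_wpM2r.
Qed.

Lemma lax_wendroff_bounded (R : realType) (q : \bar R) (al ar am : R) :
  (1 <= q)%E -> bounded_operator q (lax_wendroff al ar am).
Proof.
move=> q1; split=> [a u v _ _|].
  apply/funext => j; rewrite /lax_wendroff.
  by case: ifP => _; [ring|case: ifP => _; [ring|case: ifP => _; ring]].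
pose A (x : R) := [:: (x + x ^+ 2) / 2; 1 - x ^+ 2; (x ^+ 2 - x) / 2].
pose s := A ar ++ A al ++ [:: (al + al ^+ 2) / 2; 1 - al * (al + am) / 2;
   (ar * am - ar) / 2] ++ [:: (al + al * am) / 2; 1 - ar * (ar + am) / 2;
   (ar ^+ 2 - ar) / 2].
pose K0 := \sum_(x <- s) `|x|.
have [n nK] : exists n : nat, K0 <= n%:R.
  by exists (Num.bound K0); rewrite ltW// archi_boundP// sumr_ge0.
have Kn x : x \in s -> `|x| <= n%:R.
  move=> xs; apply: le_trans nK; rewrite /K0 (big_rem x)//=.
  by rewrite lerDl sumr_ge0.
pose f (w : int -> R[i]) k j := Normc.normc (w (j + k)).
have bnd w j : Normc.normc (lax_wendroff al ar am w j) <=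
    n%:R * (f w (-1) j + f w 0 j + f w 1 j).
  rewrite /f addr0.
  have R2 : 2^-1 = (2^-1 : R)%:C by rewrite fmorphV /= rmorphMn.
  have [a [b [c [aK bK cK ->]]]] : exists a b c : R,
      [/\ a \in s, b \in s, c \in s & lax_wendroff al ar am w j =
      a%:C * w (j + -1) + b%:C * w j + c%:C * w (j + 1)]; last first.
    by apply: normc_comb; exact: Kn.
  rewrite /lax_wendroff; case: (boolP (2 <= j)) => [_|j2].
    exists ((ar + ar ^+ 2) / 2); exists (1 - ar ^+ 2); exists ((ar ^+ 2 - ar) / 2).
    split; rewrite ?inE ?eqxx ?orbT//.
    rewrite !(rmorphD, rmorphB, rmorphM, rmorphXn, rmorph1, rmorphN) /= -R2; field => //.
  case: (boolP (j <= -1)) => [_|j1].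
    exists ((al + al ^+ 2) / 2); exists (1 - al ^+ 2); exists ((al ^+ 2 - al) / 2).
    split; rewrite ?inE ?eqxx ?orbT//.
    rewrite !(rmorphD, rmorphB, rmorphM, rmorphXn, rmorph1, rmorphN) /= -R2; field => //.
  case: (eqVneq j 0) => [->|j0].
    exists ((al + al ^+ 2) / 2); exists (1 - al * (al + am) / 2); exists ((ar * am - ar) / 2).
    split; rewrite ?inE ?eqxx ?orbT//.
    rewrite !add0r.
    rewrite !(rmorphD, rmorphB, rmorphM, rmorphXn, rmorph1, rmorphN) /= -R2; field => //.
  have -> : j = 1 by lia.
  exists ((al + al * am) / 2); exists (1 - ar * (ar + am) / 2); exists ((ar ^+ 2 - ar) / 2).
  split; rewrite ?inE ?eqxx ?orbT//.
  rewrite subrr (_ : 1 + 1 = 2)//.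
  rewrite !(rmorphD, rmorphB, rmorphM, rmorphXn, rmorph1, rmorphN) /= -R2; field => //.
have n0 (t : R[i]) : 0 <= Normc.normc t.
  by case: t => t1 t2; exact: sqrtr_ge0.
exists (n%:R * 3) => w _.
apply: (@le_trans _ _ (Lnorm (@counting int R) q
    (EFin \o (fun j => n%:R * (f w (-1) j + f w 0 j + f w 1 j))%R))).
  apply: le_Lnorm_counting => // j; rewrite ger0_norm//.
  exact: le_trans (bnd w j) (ler_norm _).
apply: (le_trans (Lnorm_counting_nat _ _ q1)).
rewrite EFinM -muleA lee_wpmul2l ?lee_fin//.
apply: (le_trans (eminkowski _ _ _ q1)) => //.
apply: (@le_trans _ _ (lqnorm q w + lqnorm q w + lqnorm q w)%E).
  apply: leeD; last by rewrite -(lqnorm_shift 1 w q1).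
  apply: (le_trans (eminkowski _ _ _ q1)) => //.
  apply: leeD; first by rewrite -(lqnorm_shift (-1) w q1).
  by rewrite -(lqnorm_shift 0 w q1).
have -> : (3 : R) = 1 + 1 + 1 by ring.
by rewrite !EFinD !ge0_muleDl ?lee_fin ?addr_ge0// !mul1e.
Qed.

(* Main.v *)
Require Import Defs.
From mathcomp Require Import all_boot all_order all_algebra.
From mathcomp Require Import all_classical all_reals all_analysis.
From mathcomp Require Import complex.
From mathcomp Require Import zify ring lra.
Import Order.TTheory GRing.Theory Num.Theory.
Import numFieldNormedType.Exports.

Set Implicit Arguments.
Unset Strict Implicit.
Unset Printing Implicit Defensive.
Local Open Scope classical_set_scope.
Local Open Scope ring_scope.
Local Open Scope complex_scope.

(* Write a = al, c = - ar, m = am, so that 0 < a, c < 1 and, by monotonicity of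
   the derivative of the flux, - c <= m <= a. On each side of the shock the
   equation z w - L w = 0 is a recurrence of order two whose two characteristic
   roots have a product of modulus (1 + a) / (1 - a) (on the right, this holds
   with c for the inverses of the roots). For |z| >= 1, z <> 1, von Neumann
   stability on an annulus yields one root of modulus < 1, hence the other one
   has modulus > (1 + a) / (1 - a). This gives a bounded inverse of the constant
   coefficient operator on each side, by geometric convolutions. Gluing the two
   inverses leaves two errors at j = 0 and j = 1, corrected by the two decaying
   modes; the 2 x 2 system is invertible because its (Lopatinskii) determinant
   is 1 - m^2 - P Q with |P| > 1 + m and |Q| > 1 - m, P and Q being expressed
   by the large roots. At z = 1 the determinant vanishes, which provides the
   eigenvector. *)

Local Notation N := Normc.normc.

(** * Counting measure and the ell^q norm *)

Section lq.
Context {R : realType}.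
Implicit Types (q : \bar R) (h u v w : int -> R[i]) (z : R[i]).

Lemma normc_ge0 z : 0 <= N z.
Proof. by case: z => a b; exact: sqrtr_ge0. Qed.

Lemma normc_real (x : R) : N x%:C = `|x|.
Proof. by rewrite /= expr0n /= addr0 sqrtr_sqr. Qed.

Lemma counting_set1 (j : int) : counting [set j] = 1%E :> \bar R.
Proof.
rewrite /counting ifT; last by apply/asboolP; exact: finite_set1.
by rewrite fset_set1 finmap.cardfs1.
Qed.

Lemma counting_setT_gt0 : (0 < @counting int R setT)%E.
Proof.
apply: (@lt_le_trans _ _ (counting [set (0 : int)])).
  by rewrite counting_set1.
by apply: (@le_measure _ _ _ (@counting int R)); rewrite ?inE.
Qed.

(** Singletons have mass one, so a negligible set is empty. *)
Lemma ae_counting (P : int -> Prop) :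
  (\forall j \ae (@counting int R), P j) -> forall j, P j.
Proof.
move=> [A [mA A0 sA]] j; apply: contrapT => nPj.
have jA : [set j] `<=` A by move=> i ->; exact: sA.
have : ((@counting int R) [set j] <= (@counting int R) A)%E.
  by apply: (@le_measure _ _ _ (@counting int R)); rewrite ?inE.
by rewrite A0 counting_set1 lee_fin ler10.
Qed.

Lemma lqnorm_pinftyP w (M : \bar R) :
  (lqnorm +oo w <= M)%E <-> forall j, ((N (w j))%:E <= M)%E.
Proof.
rewrite /lqnorm unlock counting_setT_gt0; split.
  move=> /ess_sup_inf.ess_supP/ae_counting wM j.
  by have := wM j; rewrite /= ger0_norm ?normc_ge0.
by move=> wM; apply/ess_sup_inf.ess_supP/aeW => j /=; rewrite ger0_norm ?normc_ge0.
Qed.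

Lemma lqnorm_finE (r : R) w : 1 <= r ->
  lqnorm r%:E w = ((\int[@counting int R]_j (N (w j) `^ r)%:E) `^ r^-1)%E.
Proof.
move=> r1; rewrite /lqnorm unlock; congr (_ `^ _)%E.
by apply: eq_integral => j _; rewrite /= ger0_norm ?normc_ge0.
Qed.

Lemma lqnorm_ge0 q w : (0 <= lqnorm q w)%E.
Proof. exact: Lnorm_ge0. Qed.

Lemma le_poweR_inv (r : R) (x M : \bar R) : 0 < r -> (0 <= x)%E -> (0 <= M)%E ->
  (x `^ r^-1 <= M)%E <-> (x <= M `^ r)%E.
Proof.
move=> r0 x0 M0; have ri0 : 0 <= r^-1 by rewrite invr_ge0 ltW.
have r0' := ltW r0; have rN0 : r != 0 by rewrite gt_eqF.
split => H.
  rewrite -(poweRe1 x0) -(mulVf rN0) poweRrM.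
  by apply: gt0_ler_poweR => //; rewrite in_itv/= leey ?poweR_ge0 ?M0.
rewrite -(poweRe1 M0) -(mulfV rN0) poweRrM.
by apply: gt0_ler_poweR => //; rewrite in_itv/= leey ?poweR_ge0 ?x0.
Qed.

Lemma lqnorm_finP (r : R) w (M : \bar R) : 1 <= r -> (0 <= M)%E ->
  (lqnorm r%:E w <= M)%E <->
  (\int[@counting int R]_j (N (w j) `^ r)%:E <= M `^ r)%E.
Proof.
move=> r1 M0; rewrite lqnorm_finE//; apply: le_poweR_inv => //.
  exact: lt_le_trans r1.
by apply: integral_ge0 => j _; rewrite lee_fin powR_ge0.
Qed.

(** For finite [q], the integral dominates its restriction to [[set j]]. *)
Lemma normc_le_lqnorm q w (j : int) : (1 <= q)%E -> ((N (w j))%:E <= lqnorm q w)%E.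
Proof.
case: q => [r| |]//; last by move=> _; exact: ((lqnorm_pinftyP w _).1 (lexx _) j).
rewrite lee_fin => r1; have r0 : 0 < r by exact: lt_le_trans r1.
have := (lqnorm_finP w r1 (lqnorm_ge0 r%:E w)).1 (lexx _) => H.
suff : ((N (w j))%:E `^ r <= lqnorm r%:E w `^ r)%E.
  move/(le_poweR_inv r0 (poweR_ge0 _ _) (lqnorm_ge0 _ _)).2.
  by rewrite -poweRrM mulfV ?gt_eqF// poweRe1// lee_fin normc_ge0.
apply: le_trans H.
apply: (@le_trans _ _ (\int[@counting int R]_(i in [set j]) (N (w i) `^ r)%:E)%E).
  rewrite (eq_integral (cst (N (w j) `^ r)%:E)).
    by rewrite integral_cst//= counting_set1 mule1.
  by move=> i; rewrite inE /= => ->.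
by apply: ge0_subset_integral => // i _; rewrite lee_fin powR_ge0.
Qed.

Lemma le_lqnorm q u v : (1 <= q)%E -> (forall j, N (u j) <= N (v j)) ->
  (lqnorm q u <= lqnorm q v)%E.
Proof.
by move=> q1 uv; apply: le_Lnorm_counting => // j; rewrite !ger0_norm ?normc_ge0.
Qed.

Lemma lqnormD q u v : (1 <= q)%E ->
  (lqnorm q (fun j => u j + v j)%R <= lqnorm q u + lqnorm q v)%E.
Proof.
move=> q1; apply: (@le_trans _ _ (Lnorm (@counting int R) q
    (EFin \o ((fun j => N (u j)) \+ (fun j => N (v j))))%R)).
  apply: le_Lnorm_counting => // j; rewrite /= !ger0_norm ?addr_ge0 ?normc_ge0//.
  exact: le_normcD.
exact: (@eminkowski _ _ _ (@counting int R) (fun j => N (u j)) (fun j => N (v j)) q).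
Qed.

Lemma lqnormZ q (a : R[i]) w : (1 <= q)%E ->
  (lqnorm q (fun j => a * w j)%R <= (N a)%:E * lqnorm q w)%E.
Proof.
case: q => [r| |]// q1; last first.
  apply/lqnorm_pinftyP => j; rewrite Normc.normcM EFinM.
  by rewrite lee_wpmul2l ?lee_fin ?normc_ge0// (normc_le_lqnorm _ _ q1).
have r1 : 1 <= r by rewrite -lee_fin.
have r0 : 0 < r by exact: lt_le_trans r1.
apply/lqnorm_finP => //; first by rewrite mule_ge0 ?lee_fin ?normc_ge0 ?lqnorm_ge0.
rewrite poweRM ?lqnorm_ge0 ?lee_fin ?normc_ge0//.
under eq_integral do rewrite Normc.normcM powRM ?normc_ge0// EFinM.
rewrite ge0_integralZl_EFin ?powR_ge0//; last by move=> j _; rewrite lee_fin powR_ge0.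
rewrite poweR_EFin lee_wpmul2l ?lee_fin ?powR_ge0//.
exact/(lqnorm_finP _ r1 (lqnorm_ge0 _ _)).
Qed.

Lemma continuous_powR_pos (r x : R) : 0 < x -> {for x, continuous (fun y => y `^ r)}.
Proof.
move=> x0; apply: differentiable_continuous; apply/derivable1_diffP.
by apply: derivable_powR; rewrite in_itv/= x0.
Qed.

(* Fatou's lemma for the counting measure: closed balls of ell^q are closed
   under pointwise convergence. *)
Lemma lqnorm_lim q (u : nat -> int -> R[i]) w (M : R) : (1 <= q)%E -> 0 <= M ->
  (forall n, lqnorm q (u n) <= M%:E)%E ->
  (forall j, (fun n => N (u n j)) @ \oo --> N (w j)) ->
  (lqnorm q w <= M%:E)%E.
Proof.
case: q => [r| |]// q1 M0 uM uw; last first.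
  apply/lqnorm_pinftyP => j; rewrite lee_fin.
  rewrite -(cvg_lim (@Rhausdorff R) (uw j)).
  apply: limr_le; first by apply/cvg_ex; exists (N (w j)).
  by apply: nearW => n; have := (lqnorm_pinftyP _ _).1 (uM n) j; rewrite lee_fin.
have r1 : 1 <= r by rewrite -lee_fin.
have r0 : 0 < r by exact: lt_le_trans r1.
apply/lqnorm_finP => //.
pose f n j := (N (u n j) `^ r)%:E.
apply: (@le_trans _ _ (\int[@counting int R]_j limn_einf (f^~ j))%E).
  apply: ge0_le_integral => //.
  - by move=> j _; rewrite lee_fin powR_ge0.
  (* Continuity of the power function is used only where [N (w j)] is positive; where it vanishes,
     nonnegativity of the lower limit suffices. *)
  - move=> j _; have := normc_ge0 (w j); rewrite le_eqVlt => /orP[/eqP w0|w0].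
      rewrite -w0 powR0 ?gt_eqF// limn_einf_lim.
      apply: lime_ge; first exact: is_cvg_einfs.
      apply: nearW => n; apply: le_ereal_inf_tmp => _ [m _ <-].
      by rewrite lee_fin powR_ge0.
    have fj : f^~ j @ \oo --> (N (w j) `^ r)%:E.
      apply: cvg_EFin; first by apply: nearW.
      exact: (cvg_comp _ (fun y => y `^ r) (uw j) (continuous_powR_pos w0)).
    by have [-> _] := cvg_limn_einf_sup fj.
apply: (le_trans (fatou _ _ _ _)) => //.
  by move=> n j _; rewrite lee_fin powR_ge0.
rewrite limn_einf_lim; apply: lime_le; first exact: is_cvg_einfs.
apply: nearW => n; apply: (le_trans (ereal_inf_lbound _)).
  by exists n => //=.
exact/(lqnorm_finP _ r1).
Qed.

End lq.

(** * Bounded operators and geometric convolutions *)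

Section operators.
Context {R : realType}.
Variables (q : \bar R) (q1 : (1 <= q)%E).
Implicit Types (S T : (int -> R[i]) -> (int -> R[i])) (h u v w : int -> R[i]).

Lemma bounded_operator_ell T w : bounded_operator q T -> ell q w -> ell q (T w).
Proof.
move=> [_ [M TM]] wq; apply: (le_lt_trans (TM _ wq)).
have wfin : lqnorm q w \is a fin_num by rewrite ge0_fin_numE ?lqnorm_ge0.
by rewrite -(fineK wfin) -EFinM ltry.
Qed.

Lemma bounded_operator_ge0 T : bounded_operator q T ->
  exists2 M : R, 0 <= M &
    forall w, ell q w -> (lqnorm q (T w) <= M%:E * lqnorm q w)%E.
Proof.
move=> [_ [M TM]]; exists `|M| => // w wq; apply: (le_trans (TM _ wq)).
by rewrite lee_wpmul2r ?lqnorm_ge0// lee_fin ler_norm.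
Qed.

Lemma bounded_operator_id : bounded_operator q id.
Proof. by split=> //; exists 1 => w _; rewrite mul1e. Qed.

Lemma bounded_operator_comp S T : bounded_operator q S -> bounded_operator q T ->
  bounded_operator q (fun w => S (T w)).
Proof.
move=> bS bT; split=> [a u v uq vq|].
  by rewrite bT.1// bS.1//; exact: bounded_operator_ell.
have [M M0 SM] := bounded_operator_ge0 bS.
have [M' M'0 TM'] := bounded_operator_ge0 bT.
exists (M * M') => w wq; rewrite EFinM -muleA.
apply: (le_trans (SM _ (bounded_operator_ell bT wq))).
by rewrite lee_wpmul2l ?lee_fin// TM'.
Qed.

Lemma bounded_operator_shift (k : int) : bounded_operator q (fun w j => w (j + k)).
Proof. by split=> //; exists 1 => w _; rewrite mul1e lqnorm_shift. Qed.

Lemma bounded_operatorZ (c : R[i]) T : bounded_operator q T ->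
  bounded_operator q (fun w j => c * T w j).
Proof.
move=> bT; split=> [a u v uq vq|].
  by rewrite bT.1//; apply/funext => j; ring.
have [M M0 TM] := bounded_operator_ge0 bT.
exists (N c * M) => w wq; rewrite EFinM -muleA.
apply: (le_trans (lqnormZ _ _ q1)).
by rewrite lee_wpmul2l ?lee_fin ?normc_ge0// TM.
Qed.

(** Common source of the closure under sums and under gluing. Only moduli are compared, so linearity
    of [U] is a separate assumption. *)
Lemma bounded_operator_le S T U : bounded_operator q S -> bounded_operator q T ->
  (forall (a : R[i]) u v, ell q u -> ell q v ->
     U (fun j => a * u j + v j) = (fun j => a * U u j + U v j)) ->
  (forall w j, N (U w j) <= N (S w j) + N (T w j)) ->
  bounded_operator q U.
Proof.
move=> bS bT linU UST; split=> //.
have [M M0 SM] := bounded_operator_ge0 bS.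
have [M' M'0 TM'] := bounded_operator_ge0 bT.
exists (M + M') => w wq.
pose n (f : int -> R[i]) j := (N (f j))%:C.
have nE f : lqnorm q (n f) = lqnorm q f.
  rewrite /lqnorm; congr Lnorm; apply/funext => j.
  by rewrite normc_real ger0_norm ?normc_ge0.
apply: (@le_trans _ _ (lqnorm q (fun j => n (S w) j + n (T w) j))).
  apply: le_lqnorm => // j; rewrite -rmorphD normc_real.
  exact: le_trans (UST w j) (ler_norm _).
apply: (le_trans (lqnormD _ _ q1)); rewrite !nE EFinD ge0_muleDl ?lee_fin//.
by rewrite leeD ?SM ?TM'.
Qed.

Lemma bounded_operatorD S T : bounded_operator q S -> bounded_operator q T ->
  bounded_operator q (fun w j => S w j + T w j).
Proof.
move=> bS bT; apply: (bounded_operator_le bS bT) => [a u v uq vq|w j].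
  by rewrite bS.1// bT.1//; apply/funext => j; ring.
exact: le_normcD.
Qed.

Lemma bounded_operator_glue (P : pred int) S T :
  bounded_operator q S -> bounded_operator q T ->
  bounded_operator q (fun w j => if P j then S w j else T w j).
Proof.
move=> bS bT; apply: (bounded_operator_le bS bT) => [a u v uq vq|w j].
  by rewrite bS.1// bT.1//; apply/funext => j; case: ifP.
by case: ifP => _; rewrite ?lerDl ?lerDr normc_ge0.
Qed.

(** Evaluation at [j0] is a bounded functional, by [normc_le_lqnorm]. *)
Lemma bounded_operator_rank1 T (j0 : int) (phi : int -> R[i]) :
  bounded_operator q T -> ell q phi ->
  bounded_operator q (fun w j => T w j0 * phi j).
Proof.
move=> bT phiq; split=> [a u v uq vq|].
  by rewrite bT.1//; apply/funext => j; ring.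
have [M M0 TM] := bounded_operator_ge0 bT.
have pfin : lqnorm q phi \is a fin_num by rewrite ge0_fin_numE ?lqnorm_ge0.
have p0 : 0 <= fine (lqnorm q phi) by rewrite fine_ge0 ?lqnorm_ge0.
exists (M * fine (lqnorm q phi)) => w wq.
apply: (le_trans (lqnormZ _ _ q1)).
rewrite EFinM fineK// -muleA (muleC (lqnorm q phi)) muleA.
rewrite lee_wpmul2r ?lqnorm_ge0//.
by apply: le_trans (TM _ wq); exact: normc_le_lqnorm.
Qed.

Lemma ellD u v : ell q u -> ell q v -> ell q (fun j => u j + v j).
Proof.
by move=> uq vq; apply: (le_lt_trans (lqnormD _ _ q1)); rewrite lte_add_pinfty.
Qed.

Lemma ellZ (c : R[i]) u : ell q u -> ell q (fun j => c * u j).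
Proof. exact: bounded_operator_ell (bounded_operatorZ c bounded_operator_id). Qed.

Lemma ell_bounded w : ell q w -> exists M : R, forall j, N (w j) <= M.
Proof.
move=> wq; have wfin : lqnorm q w \is a fin_num by rewrite ge0_fin_numE ?lqnorm_ge0.
exists (fine (lqnorm q w)) => j; rewrite -lee_fin fineK//.
exact: normc_le_lqnorm.
Qed.

Lemma ell_delta (j0 : int) : ell q (fun j => (j == j0)%:R).
Proof.
rewrite /ell /=; case: q q1 => [r| |]// r1; last first.
  apply: (@le_lt_trans _ _ 1%:E); last exact: ltry.
  apply/lqnorm_pinftyP => j; rewrite lee_fin.
  by case: eqP => _; rewrite ?Normc.normc1 ?Normc.normc0.
rewrite lee_fin in r1; have r0 : 0 < r by exact: lt_le_trans r1.
rewrite lqnorm_finE//; apply: poweR_lty.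
rewrite (eq_integral (fun j => (\1_[set j0] j)%:E)).
  by rewrite integral_indic// setIT /= counting_set1 ltry.
move=> j _; rewrite indicE; case: eqP => [->|jj0].
  by rewrite mem_set// Normc.normc1 powR1.
by rewrite memNset// Normc.normc0 powR0 ?gt_eqF.
Qed.

End operators.

(** * Geometric series and recurrences over the integers *)

Section geometric.
Context {R : realType}.
Implicit Types (z l kappa : R[i]) (a : nat -> R[i]) (h u v w : int -> R[i]).

Lemma normc_le_ReIm z : N z <= `|complex.Re z| + `|complex.Im z|.
Proof.
case: z => x y /=; rewrite -[leRHS]ger0_norm ?addr_ge0// -sqrtr_sqr.
rewrite ler_wsqrtr// sqrrD !real_normK ?num_real// -addrA lerD2l lerDr.
by rewrite mulrn_wge0 ?mulr_ge0.
Qed.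

Lemma normr_Re_le z : `|complex.Re z| <= N z.
Proof. by rewrite -lecR; exact: normc_ge_Re. Qed.

Lemma normr_Im_le z : `|complex.Im z| <= N z.
Proof.
by case: z => x y /=; rewrite -sqrtr_sqr ler_wsqrtr// lerDr sqr_ge0.
Qed.

Lemma normcB_dist z l : `|N z - N l| <= N (z - l).
Proof.
have zl := le_normcD (z - l) l; have lz := le_normcD (l - z) z.
have nzl : N (l - z) = N (z - l) by rewrite -normcN opprB.
rewrite !subrK nzl in zl lz.
rewrite ler_norml; lra.
Qed.

(** Real and imaginary parts converge absolutely, by comparison with a real geometric series.
    Convergence is stated through [N], so that only limits in [R] occur. *)
Lemma cvg_geometric_majorant a (M rho : R) : 0 <= rho < 1 ->
  (forall i, N (a i) <= M * rho ^+ i) ->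
  exists l, (fun n => N (\sum_(0 <= i < n) a i - l)) @ \oo --> 0.
Proof.
move=> /andP[rho0 rho1] aM.
have cv (b : nat -> R) : (forall i, `|b i| <= N (a i)) -> cvgn (series b).
  move=> ba; apply: normed_cvg.
  apply: (@series_le_cvg _ _ (geometric M rho)) => [n|n|n|].
  - exact: normr_ge0.
  - exact: le_trans (normc_ge0 _) (aM n).
  - exact: le_trans (ba n) (aM n).
  - by apply: is_cvg_geometric_series; rewrite ger0_norm.
have cR := cv _ (fun i => normr_Re_le (a i)).
have cI := cv _ (fun i => normr_Im_le (a i)).
set r := limn _ in cR; set s := limn _ in cI.
exists (r +i* s).
have Re_sum n : complex.Re (\sum_(0 <= i < n) a i) = series (fun i => complex.Re (a i)) n.
  by rewrite /series /=; apply: big_morph => // -[x y] [x' y'].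
have Im_sum n : complex.Im (\sum_(0 <= i < n) a i) = series (fun i => complex.Im (a i)) n.
  by rewrite /series /=; apply: big_morph => // -[x y] [x' y'].
apply: (@squeeze_cvgr _ _ _ _ (fun=> 0)
  (fun n => `|series (fun i => complex.Re (a i)) n - r| +
            `|series (fun i => complex.Im (a i)) n - s|)).
- apply: nearW => n; rewrite normc_ge0 /=.
  apply: le_trans (normc_le_ReIm _) _; rewrite -Re_sum -Im_sum.
  by case: (\sum_(_ <= _ < _) _).
- exact: cvg_cst.
- rewrite -[X in _ --> X](addr0 0); apply: cvgD.
    by apply/norm_cvg0P; rewrite -(subrr r); apply: cvgB => //; exact: cvg_cst.
  by apply/norm_cvg0P; rewrite -(subrr s); apply: cvgB => //; exact: cvg_cst.
Qed.

Lemma normc_exp z n : N (z ^+ n) = N z ^+ n.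
Proof.
by elim: n => [|n IH]; rewrite ?expr0 ?Normc.normc1// !exprS Normc.normcM IH.
Qed.

(** Iteration gives [a i = kappa ^+ n * a (n + i)], of modulus at most [M * N kappa ^+ n], which
    tends to 0. *)
Lemma geometric_unique kappa a (M : R) : N kappa < 1 ->
  (forall n, N (a n) <= M) -> (forall n, a n = kappa * a n.+1) ->
  forall n, a n = 0.
Proof.
move=> k1 aM aE i; apply: Normc.eq0_normc.
have an n : N (a i) <= M * N kappa ^+ n.
  have -> : a i = kappa ^+ n * a (n + i)%N.
    by elim: n => [|n IH]; rewrite ?mul1r// IH aE exprSr -mulrA.
  by rewrite Normc.normcM normc_exp mulrC ler_wpM2r ?exprn_ge0 ?normc_ge0.
apply/eqP; rewrite eq_le normc_ge0 andbT.
have cv : geometric M (N kappa) @ \oo --> 0.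
  by apply: cvg_geometric; rewrite ger0_norm ?normc_ge0.
rewrite -(cvg_lim (@Rhausdorff R) cv); apply: limr_ge.
  by apply/cvg_ex; exists 0.
by apply: nearW => n; exact: an.
Qed.

(** The solution is the series with terms [kappa ^+ i * h (j + k * i)]. Its partial sums are
    iterates of the fixed-point equation, one iteration preserves the norm bound, and [lqnorm_lim]
    carries the bound to the limit. *)
Lemma geometric_solution (q : \bar R) kappa (k : int) h : (1 <= q)%E ->
  N kappa < 1 -> ell q h ->
  exists w, (lqnorm q w <= ((1 - N kappa)^-1)%:E * lqnorm q h)%E /\
    forall j, w j = h j + kappa * w (j + k).
Proof.
move=> q1 k1 hq; have [M hM] := ell_bounded q1 hq.
have k0 := normc_ge0 kappa.
pose s n j := \sum_(0 <= i < n) kappa ^+ i * h (j + k * i%:Z).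
have /choice[w sw] : forall j, exists l, (fun n => N (s n j - l)) @ \oo --> 0.
  move=> j; apply: (@cvg_geometric_majorant _ M (N kappa)); first by rewrite k0.
  by move=> i; rewrite Normc.normcM normc_exp mulrC ler_wpM2r ?exprn_ge0.
have sS n j : s n.+1 j = h j + kappa * s n (j + k).
  rewrite /s big_nat_recl// mul1r mulr0 addr0; congr (_ + _).
  rewrite mulr_sumr; apply: eq_bigr => i _.
  by rewrite exprS mulrA; congr (_ * h _); rewrite -addn1 PoszD mulrDr mulr1; ring.
have hfin : lqnorm q h \is a fin_num by rewrite ge0_fin_numE ?lqnorm_ge0.
pose H := fine (lqnorm q h).
have H0 : 0 <= H by rewrite fine_ge0 ?lqnorm_ge0.
have hH : lqnorm q h = H%:E by rewrite fineK.
exists w; split.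
  rewrite hH -EFinM; apply: (lqnorm_lim q1 (u := s)).
  - by rewrite mulr_ge0// invr_ge0 subr_ge0 ltW.
  - elim=> [|n IH].
      rewrite (_ : s 0%N = fun=> 0); last by apply/funext => j; rewrite /s big_nil.
      apply: (@le_trans _ _ ((N 0)%:E * lqnorm q h)%E).
        rewrite -(_ : (fun j => 0 * h j) = fun=> 0); first exact: lqnormZ.
        by apply/funext => j; rewrite mul0r.
      by rewrite Normc.normc0 mul0e lee_fin mulr_ge0// invr_ge0 subr_ge0 ltW.
    rewrite (_ : s n.+1 = fun j => h j + kappa * s n (j + k)); last exact/funext.
    apply: (le_trans (lqnormD _ _ q1)).
    apply: (@le_trans _ _ (H%:E + (N kappa)%:E * ((1 - N kappa)^-1 * H)%:E)%E).
      rewrite hH leeD2l//; apply: (le_trans (lqnormZ _ _ q1)).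
      by rewrite lee_wpmul2l ?lee_fin// lqnorm_shift.
    rewrite -EFinM -EFinD lee_fin le_eqVlt; apply/orP; left; apply/eqP.
    by field; rewrite subr_eq0 gt_eqF.
  - move=> j; have := sw j; move/cvgrPdist_le => cv; apply/cvgrPdist_le => e e0.
    apply: filterS (cv e e0) => n; rewrite sub0r normrN ger0_norm ?normc_ge0//.
    by apply: le_trans; rewrite distrC normcB_dist.
move=> j; apply/eqP; rewrite -subr_eq0; apply/eqP/Normc.eq0_normc.
apply/eqP; rewrite eq_le normc_ge0 andbT.
have cv : (fun n => N (s n.+1 j - w j) + N kappa * N (s n (j + k) - w (j + k)))
    @ \oo --> 0 + N kappa * 0.
  apply: cvgD; last by apply: cvgMr; exact: sw.
  by rewrite (cvg_shiftS (fun n => N (s n j - w j))); exact: sw.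
rewrite mulr0 addr0 in cv.
rewrite -(cvg_lim (@Rhausdorff R) cv); apply: limr_ge.
  by apply/cvg_ex; exists 0.
apply: nearW => n; rewrite -Normc.normcM -(normcN (s n.+1 j - w j)).
apply: le_trans (le_normcD _ _); rewrite sS le_eqVlt; apply/orP; left; apply/eqP.
by congr (N _); ring.
Qed.

(** A solution is chosen separately for each [h]. Linearity is recovered from uniqueness: its defect
    [d] is bounded and satisfies [d i = kappa * d (i + k)], so [geometric_unique] applies along
    [j + k * n]. *)
Lemma geometric_operator (q : \bar R) kappa (k : int) : (1 <= q)%E ->
  N kappa < 1 ->
  exists2 K : (int -> R[i]) -> (int -> R[i]), bounded_operator q K &
    forall h, ell q h -> forall j, K h j = h j + kappa * K h (j + k).
Proof.
move=> q1 k1.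
have /choice[K KP] : forall h, exists w, ell q h ->
    (lqnorm q w <= ((1 - N kappa)^-1)%:E * lqnorm q h)%E /\
    forall j, w j = h j + kappa * w (j + k).
  move=> h; have [hq|] := pselect (ell q h); last by exists h.
  by have [w wP] := geometric_solution k q1 k1 hq; exists w.
have KE h hq := (KP h hq).2.
exists K; last exact: KE.
have Kell h : ell q h -> ell q (K h).
  move=> hq; apply: (le_lt_trans (KP h hq).1).
  have hfin : lqnorm q h \is a fin_num by rewrite ge0_fin_numE ?lqnorm_ge0.
  by rewrite -(fineK hfin) -EFinM ltry.
split; last by exists (1 - N kappa)^-1 => w wq; exact: (KP w wq).1.
move=> a u v uq vq; apply/funext => j; apply/eqP; rewrite -subr_eq0; apply/eqP.
have uvq : ell q (fun j => a * u j + v j) by apply: ellD => //; exact: ellZ.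
pose d i := K (fun j => a * u j + v j) i - (a * K u i + K v i).
have [M dM] : exists M, forall i, N (d i) <= M.
  apply: (ell_bounded q1); apply: (ellD q1); first exact: Kell.
  rewrite (_ : (fun j => - _) = fun j => (- 1) * (a * K u j + K v j)).
    by apply: (ellZ q1); apply: (ellD q1); [apply: (ellZ q1)|]; exact: Kell.
  by apply/funext => i; rewrite mulN1r.
rewrite -/(d j) -(addr0 j) -(mulr0 k).
apply: (geometric_unique (a := fun n => d (j + k * n%:Z)) k1 _ _ 0) => // n.
rewrite /d (KE _ uvq) (KE u uq) (KE v vq).
have -> : j + k * n.+1%:Z = j + k * n%:Z + k by lia.
by ring.
Qed.

(* The difference operator is A (T - r2) (1 - r1 T^-1), where T is the shift. *)
Lemma recurrence_operator (q : \bar R) (A r1 r2 : R[i]) : (1 <= q)%E ->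
  A != 0 -> N r1 < 1 -> 1 < N r2 ->
  exists2 S : (int -> R[i]) -> (int -> R[i]), bounded_operator q S &
    forall h, ell q h -> forall j,
      A * S h (j + 1) - A * (r1 + r2) * S h j + A * r1 * r2 * S h (j - 1) = h j.
Proof.
move=> q1 A0 r1lt r2gt.
have r20 : r2 != 0 by apply: contraTneq r2gt => ->; rewrite Normc.normc0 ltr10.
have r2V : N r2^-1 < 1 by rewrite Normc.normcV invf_lt1// (lt_trans _ r2gt).
have [K bK KE] := geometric_operator (-1) q1 r1lt.
have [L bL LE] := geometric_operator 1 q1 r2V.
(* As [A (T - r2) = - A r2 (1 - r2^-1 T)], its inverse is [c L], while [K] inverts [1 - r1 T^-1]. *)
pose c := - (A * r2)^-1.
have bcL := bounded_operatorZ q1 c bL.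
exists (fun h => K (fun j => c * L h j)); first exact: (bounded_operator_comp bK).
move=> h hq j; have cLq := bounded_operator_ell bcL hq.
rewrite [K _ (j + 1)](KE _ cLq) addrK [K _ j](KE _ cLq).
rewrite [L h j](LE _ hq) /c.
by field; rewrite A0 r20.
Qed.

End geometric.

(** * Characteristic roots and the Lopatinskii determinant *)

Section characteristic.
Context {R : realType}.
Implicit Types (a m : R) (z k nu : R[i]).

(* With k = x + i y, s = |k|^2 and t = (a^2 + a)/2 - (a - a^2)/2 s, one has
   a^2 s |z|^2 = a^2 (1 - a^2) s + t^2 - (1 - a^2) (a^2 x - t)^2
   and 0 <= t <= a^2 on the annulus. *)
Lemma lax_wendroff_annulus a z k : 0 < a < 1 -> 1 <= N z -> 1 <= N k ->
  (1 - a) * N k ^+ 2 <= 1 + a ->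
  z * k = (1 - a ^+ 2)%:C * k + ((a ^+ 2 + a) / 2)%:C + ((a ^+ 2 - a) / 2)%:C * (k * k) ->
  z = 1.
Proof.
case: z k => [c d] [x y] /andP[a0 a1] z1 k1 k2 E.
have sqN (u v : R) : N (u +i* v) ^+ 2 = u ^+ 2 + v ^+ 2.
  by rewrite /= sqr_sqrtr// addr_ge0 ?sqr_ge0.
have {}z1 : 1 <= c ^+ 2 + d ^+ 2 by rewrite -sqN expr_ge1// normc_ge0.
rewrite sqN in k2.
have {}k1 : 1 <= x ^+ 2 + y ^+ 2 by rewrite -sqN expr_ge1// normc_ge0.
have := congr1 (@complex.Re R) E; have := congr1 (@complex.Im R) E => /= eI eR.
set s := x ^+ 2 + y ^+ 2 in k1 k2.
pose t := (a ^+ 2 + a) / 2 - (a - a ^+ 2) / 2 * s.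
have s0 : 0 < s by lra.
(* Multiplying the equation by the conjugate of [k] isolates the real and imaginary parts of [z],
   scaled by [s]. *)
have ec : c * s = (1 - a ^+ 2) * s + t * x.
  have -> : c * s = x * (c * x - d * y) + y * (c * y + d * x) by rewrite /s; ring.
  by rewrite eR eI /t /s; field.
have ed : d * s = - ((a ^+ 2 + a) / 2 + (a - a ^+ 2) / 2 * s) * y.
  have -> : d * s = x * (c * y + d * x) - y * (c * x - d * y) by rewrite /s; ring.
  by rewrite eR eI /s; field.
have key : (c ^+ 2 + d ^+ 2) * a ^+ 2 * s =
    (1 - a ^+ 2) * a ^+ 2 * s + t ^+ 2 - (1 - a ^+ 2) * (a ^+ 2 * x - t) ^+ 2.
  apply: (mulIf (lt0r_neq0 s0)).
  have -> : (c ^+ 2 + d ^+ 2) * a ^+ 2 * s * s =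
      a ^+ 2 * ((c * s) ^+ 2 + (d * s) ^+ 2) by ring.
  by rewrite ec ed /t /s; field.
have t0 : 0 <= t.
  have -> : t = a / 2 * ((1 + a) - (1 - a) * s) by rewrite /t; field.
  by apply: mulr_ge0; lra.
have ta : t <= a ^+ 2.
  have -> : t = a ^+ 2 - a * (1 - a) / 2 * (s - 1) by rewrite /t; field.
  by rewrite gerBl; do ?apply: mulr_ge0; lra.
have a20 : 0 < a ^+ 2 by rewrite exprn_gt0.
have a21 : a ^+ 2 < 1 by rewrite expr_lt1// ltW.
have tt : t ^+ 2 <= a ^+ 2 * a ^+ 2 by rewrite expr2 ler_pM.
(* This is [1 <= |z|^2] inserted in [key]. With [t <= a^2] and [1 <= s] it forces equality
   everywhere, so [k = 1] and then [z = 1]. *)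
have big : a ^+ 2 * a ^+ 2 * s + (1 - a ^+ 2) * (a ^+ 2 * x - t) ^+ 2 <= t ^+ 2.
  have : a ^+ 2 * s <= (c ^+ 2 + d ^+ 2) * a ^+ 2 * s.
    by rewrite ler_pM2r// ler_peMl// ltW.
  by rewrite key; lra.
have sq0 : 0 <= (1 - a ^+ 2) * (a ^+ 2 * x - t) ^+ 2.
  by rewrite mulr_ge0 ?sqr_ge0// subr_ge0 ltW.
have a40 : 0 < a ^+ 2 * a ^+ 2 by rewrite mulr_gt0.
have s1 : s = 1.
  apply/eqP; rewrite eq_le k1 andbT -(ler_pM2l a40) mulr1; lra.
have ta2 : t = a ^+ 2 by rewrite /t s1; field.
have x1 : x = 1.
  have : (1 - a ^+ 2) * (a ^+ 2 * x - t) ^+ 2 = 0.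
    by apply/eqP; rewrite eq_le sq0 andbT; rewrite s1 in big; lra.
  move/eqP; rewrite mulf_eq0 subr_eq0 gt_eqF//= expf_eq0 /= subr_eq0 ta2 => /eqP e.
  by apply: (mulfI (lt0r_neq0 a20)); rewrite mulr1.
have y0 : y = 0.
  apply/eqP; rewrite -sqrf_eq0; apply/eqP.
  by move: s1; rewrite /s x1 expr1n; lra.
apply/eqP; rewrite eq_complex /=; apply/andP; split; apply/eqP.
  by move: ec; rewrite s1 ta2 x1 !mulr1 => ->; ring.
by move: ed; rewrite s1 y0 mulr1 mulr0.
Qed.

Lemma real_complex1D (x : R) : (1 : R[i]) + x%:C = (1 + x)%:C.
Proof. by rewrite rmorphD rmorph1. Qed.

Lemma real_complex1B (x : R) : (1 : R[i]) - x%:C = (1 - x)%:C.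
Proof. by rewrite rmorphB rmorph1. Qed.

Lemma real_complex_neq0 (x : R) : (x%:C != 0 :> R[i]) = (x != 0).
Proof. by rewrite fmorph_eq0. Qed.

(** The smaller root has squared modulus at most the modulus [(1 + a) / (1 - a)] of the product of
    the roots. Were its modulus at least 1, it would lie in the annulus of [lax_wendroff_annulus],
    which forces [z = 1]. *)
Lemma lax_wendroff_root a z : 0 < a < 1 -> 1 <= N z -> z != 1 ->
  exists nu, [/\ nu != 0, N nu < 1 &
    z = 1 - a%:C ^+ 2 + (a%:C ^+ 2 + a%:C) / 2 / nu + (a%:C ^+ 2 - a%:C) / 2 * nu].
Proof.
move=> a01 z1 zN1; have /andP[a0 a1] := a01.
set A := a%:C.
have A0 : A != 0 by rewrite real_complex_neq0 gt_eqF.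
have A1 : 1 - A != 0 by rewrite real_complex1B real_complex_neq0 subr_eq0 gt_eqF.
have A1' : 1 + A != 0.
  by rewrite real_complex1D real_complex_neq0 gt_eqF// addr_gt0.
have P0 : 0 < (1 + a) / (1 - a) by rewrite divr_gt0 ?subr_gt0// addr_gt0.
have cE : (2^-1 : R[i]) = (2^-1)%:C by rewrite fmorphV rmorph_nat.
(* The smaller of the two roots k1 and k2 lies in the annulus or in the unit disk. *)
pose B := 1 - A ^+ 2 - z.
pose D := sqrtc (B ^+ 2 + A ^+ 2 * (1 - A ^+ 2)).
pose k1 := (B + D) / (A * (1 - A)); pose k2 := (B - D) / (A * (1 - A)).
have DE : D ^+ 2 = B ^+ 2 + A ^+ 2 * (1 - A ^+ 2) by rewrite sqr_sqrtc.
have prod : k1 * k2 = - ((1 + A) / (1 - A)).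
  have -> : k1 * k2 = (B ^+ 2 - D ^+ 2) / (A * (1 - A)) ^+ 2.
    by rewrite /k1 /k2; field; rewrite A0 A1.
  by rewrite DE; field; rewrite A0 A1.
have sum : k1 + k2 = 2 * B / (A * (1 - A)) by rewrite /k1 /k2; field; rewrite A0 A1.
have root k : k = k1 \/ k = k2 ->
    z * k = (1 - A ^+ 2) * k + (A ^+ 2 + A) / 2 + (A ^+ 2 - A) / 2 * (k * k).
  move=> kk; have : (k - k1) * (k - k2) = 0.
    by case: kk => ->; rewrite subrr ?mul0r ?mulr0.
  have -> : (k - k1) * (k - k2) = k ^+ 2 - (k1 + k2) * k + k1 * k2 by ring.
  rewrite sum prod => e; apply: subr0_eq.
  rewrite -[RHS](mulr0 ((A - A ^+ 2) / 2)) -e /B; field; rewrite A0 A1//.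
have nprod : N k1 * N k2 = (1 + a) / (1 - a).
  rewrite -Normc.normcM prod normcN real_complex1D real_complex1B -fmorph_div normc_real.
  by rewrite ger0_norm// ltW.
have good k k' : N k * N k' = (1 + a) / (1 - a) -> N k <= N k' -> k = k1 \/ k = k2 ->
    exists nu, [/\ nu != 0, N nu < 1 &
    z = 1 - A ^+ 2 + (A ^+ 2 + A) / 2 / nu + (A ^+ 2 - A) / 2 * nu].
  move=> kk' lekk' kroot.
  have k0 : k != 0.
    by apply: contraTneq P0 => k0; rewrite -kk' k0 Normc.normc0 mul0r ltxx.
  exists k; split=> //; last first.
    by apply: (mulIf k0); rewrite (root _ kroot); field.
  rewrite ltNge; apply/negP => kge1; move/eqP: zN1; apply.
  apply: (lax_wendroff_annulus a01 z1 kge1).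
    rewrite mulrC -ler_pdivlMr ?subr_gt0// -kk' expr2 ler_wpM2l//; exact: normc_ge0.
  rewrite (root _ kroot) !(rmorphD, rmorphB, rmorphM, rmorphXn, rmorph1, rmorphN) /= cE.
  by [].
have [le12|/ltW le21] := leP (N k1) (N k2).
  by apply: (good k1 k2) => //; left.
by apply: (good k2 k1) => //; [rewrite mulrC|right].
Qed.

(* - (1 + a) / nu is (1 - a) times the large characteristic root. *)
Lemma normc_far a m nu : 0 < a < 1 -> -1 < m <= a -> nu != 0 -> N nu < 1 ->
  1 + m < N (- (1 + a%:C) / nu + a%:C - m%:C).
Proof.
move=> /andP[a0 a1] /andP[m1 ma] nu0 nu1.
set X := - _ / nu.
have NX : 1 + a < N X.
  rewrite Normc.normcM Normc.normcV normcN real_complex1D normc_real ger0_norm; last lra.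
  rewrite ltr_pdivlMr; last first.
    by rewrite lt_def normc_ge0 andbT; apply: contra nu0 => /eqP/Normc.eq0_normc ->.
  by rewrite gtr_pMr//; lra.
have := le_normcD (X + a%:C - m%:C) (m - a)%:C.
rewrite normc_real ler0_norm ?subr_le0// rmorphB.
have -> : X + a%:C - m%:C + (m%:C - a%:C) = X by ring.
lra.
Qed.

(** [normc_far] for [(a, m)] and for [(c, - m)] gives a product of modulus larger than
    [(1 + m) (1 - m)], which is the modulus of [1 - m^2] since [|m| < 1]. *)
Lemma lopatinskii_neq0 a c m nul nur : 0 < a < 1 -> 0 < c < 1 -> - c <= m <= a ->
  nul != 0 -> N nul < 1 -> nur != 0 -> N nur < 1 ->
  (1 - m%:C ^+ 2) - (- (1 + a%:C) / nul + a%:C - m%:C) *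
                    (- (1 + c%:C) / nur + c%:C + m%:C) != 0.
Proof.
move=> a01 c01 /andP[cm ma] l0 l1 r0 r1.
have mN1 : -1 < m <= a by rewrite ma andbT; case/andP: c01; lra.
have m1 : -1 < - m <= c by case/andP: a01; lra.
have fl := normc_far a01 mN1 l0 l1; have := normc_far c01 m1 r0 r1.
rewrite rmorphN opprK => fr.
rewrite subr_eq0; apply/eqP => /(congr1 (@Normc.normc R)); rewrite Normc.normcM => e.
have : N (1 - m%:C ^+ 2) = (1 + m) * (1 - m).
  rewrite -rmorphXn real_complex1B normc_real ger0_norm; first ring.
  have -> : 1 - m ^+ 2 = (1 + m) * (1 - m) by ring.
  by case/andP: a01 => *; rewrite mulr_ge0; lra.
rewrite e => e'; have : (1 + m) * (1 - m) < (1 + m) * (1 - m).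
  by rewrite -[ltRHS]e'; apply: ltr_pM => //; case/andP: a01; lra.
by rewrite ltxx.
Qed.

End characteristic.

(** * Resolvent and eigenvector of the linearized scheme *)

Section lax_wendroff.
Context {R : realType}.
Variables (al ar am : R).
Implicit Types (w : int -> R[i]) (j : int) (z : R[i]).

Let A := al%:C.
Let B := ar%:C.
Let M := am%:C.

Lemma lax_wendroff_ge2 w j : 2 <= j -> lax_wendroff al ar am w j =
  (B ^+ 2 - B) / 2 * w (j + 1) + (1 - B ^+ 2) * w j + (B ^+ 2 + B) / 2 * w (j - 1).
Proof.
move=> j2; rewrite /lax_wendroff j2 /B.
rewrite !(rmorphM, rmorphXn) /= fmorphV rmorph_nat; field => //.
Qed.

Lemma lax_wendroff_leN1 w j : j <= -1 -> lax_wendroff al ar am w j =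
  (A ^+ 2 - A) / 2 * w (j + 1) + (1 - A ^+ 2) * w j + (A ^+ 2 + A) / 2 * w (j - 1).
Proof.
move=> j1; rewrite /lax_wendroff j1 ifF /A; last lia.
rewrite !(rmorphM, rmorphXn) /= fmorphV rmorph_nat; field => //.
Qed.

Lemma lax_wendroff_0 w : lax_wendroff al ar am w 0 =
  2^-1 * ((B * M - B) * w 1 + (2 - A * (A + M)) * w 0 + (A ^+ 2 + A) * w (- 1)).
Proof.
rewrite /lax_wendroff /= /A /B /M !(rmorphM, rmorphXn, rmorphD) /=; field => //.
Qed.

Lemma lax_wendroff_1 w : lax_wendroff al ar am w 1 =
  2^-1 * ((B ^+ 2 - B) * w 2 + (2 - B * (B + M)) * w 1 + (A * M + A) * w 0).
Proof.
rewrite /lax_wendroff /= /A /B /M !(rmorphM, rmorphXn, rmorphD) /=; field => //.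
Qed.

End lax_wendroff.

(** * Decaying modes on the two half-lines *)

Section modes.
Context {R : realType}.
Implicit Types (w : int -> R[i]) (kappa nu : R[i]).

(** The recurrence has roots [kappa] and [nu^-1]. Filtering out [kappa] leaves
    [a n = nu * a (n + 1)], a growing sequence unless it vanishes, so boundedness kills it. *)
Lemma bounded_recurrence_right kappa nu w (K : R) : nu != 0 -> N nu < 1 ->
  (forall j, N (w j) <= K) ->
  (forall j, 2 <= j -> nu * w (j + 1) - (1 + kappa * nu) * w j + kappa * w (j - 1) = 0) ->
  forall j, 1 <= j -> w (j + 1) = kappa * w j.
Proof.
move=> nu0 nu1 wK rec j j1; apply/eqP; rewrite -subr_eq0.
pose a n := w (1 + n%:Z + 1) - kappa * w (1 + n%:Z).
have ej : 1 + `|j - 1|%N%:Z = j by lia.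
have -> : w (j + 1) - kappa * w j = a `|j - 1|%N by rewrite /a ej.
have bnd n : N (a n) <= K + N kappa * K.
  apply: (le_trans (le_normcD _ _)); rewrite normcN Normc.normcM.
  by rewrite lerD// ler_wpM2l ?normc_ge0.
apply/eqP; apply: (geometric_unique nu1 bnd) => n.
have i2 : 2 <= 1 + n.+1%:Z by lia.
have e1 : 1 + n.+1%:Z - 1 = 1 + n%:Z by lia.
have e2 : 1 + n%:Z + 1 = 1 + n.+1%:Z by lia.
have := rec _ i2; rewrite /a e1 e2 => e.
by apply: subr0_eq; rewrite -[RHS]oppr0 -e; ring.
Qed.

(** The reflection [j -> 1 - j] exchanges the two half-lines. *)
Lemma bounded_recurrence_left mu nu w (K : R) : nu != 0 -> N nu < 1 ->
  (forall j, N (w j) <= K) ->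
  (forall j, j <= -1 -> nu * w (j - 1) - (1 + mu * nu) * w j + mu * w (j + 1) = 0) ->
  forall j, j <= 0 -> w (j - 1) = mu * w j.
Proof.
move=> nu0 nu1 wK rec j j0.
have := @bounded_recurrence_right mu nu (fun i => w (1 - i)) K nu0 nu1
  (fun i => wK _) _ (1 - j) _.
have e1 : 1 - (1 - j + 1) = j - 1 by lia.
have e2 : 1 - (1 - j) = j by lia.
rewrite e1 e2; apply; last by lia.
move=> i i2; have i1 : 1 - i <= -1 by lia.
have e3 : 1 - (i + 1) = 1 - i - 1 by lia.
have e4 : 1 - (i - 1) = 1 - i + 1 by lia.
by rewrite e3 e4 rec.
Qed.

(** The mode is the response of the geometric convolution to a unit mass at 0, so membership in
    [ell q] follows from boundedness of the operator. *)
Lemma half_line_mode (q : \bar R) kappa (k : int) : (1 <= q)%E -> N kappa < 1 ->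
  exists2 phi : int -> R[i], ell q phi &
    (forall j, phi j = (j == 0)%:R + kappa * phi (j + k)).
Proof.
move=> q1 k1; have [K bK KE] := geometric_operator k q1 k1.
have dq := ell_delta q1 0.
by exists (K (fun j => (j == 0)%:R)); [exact: bounded_operator_ell dq|exact: KE].
Qed.

(* [phi_j = kappa^(j - 1)] for [j >= 1] and [phi_j = 0] otherwise. *)
Lemma right_mode (q : \bar R) kappa : (1 <= q)%E -> N kappa < 1 ->
  exists2 phi : int -> R[i], ell q phi &
    [/\ phi 1 = 1, forall j, j <= 0 -> phi j = 0 &
        forall j, 1 <= j -> phi (j + 1) = kappa * phi j].
Proof.
move=> q1 k1; have [phi phiq phiE] := half_line_mode (-1) q1 k1.
have [K phiK] := ell_bounded q1 phiq.
(* Below the source the relation is homogeneous, so the bounded sequence read towards minus infinity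
   vanishes by [geometric_unique]. *)
have phi0 j : j < 0 -> phi j = 0.
  move=> j0; pose a n := phi (-1 - n%:Z).
  have ej : -1 - `|(-1 - j)%R|%N%:Z = j by lia.
  rewrite -ej -/(a _).
  apply: (geometric_unique (a := a) (M := K) k1) => n; first exact: phiK.
  rewrite /a phiE; have -> : (-1 - n%:Z == 0) = false by apply/eqP; lia.
  by rewrite add0r; congr (_ * phi _); lia.
exists (fun j => phi (j - 1)).
  exact: (bounded_operator_ell (bounded_operator_shift q1 (-1)) phiq).
split=> [|j j0|j j1].
- by rewrite subrr phiE eqxx phi0// mulr0 addr0.
- by rewrite phi0//; lia.
- rewrite addrK phiE; have -> : (j == 0) = false by apply/eqP; lia.
  by rewrite add0r.
Qed.

(* [phi_j = mu^(- j)] for [j <= 0] and [phi_j = 0] otherwise. *)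
Lemma left_mode (q : \bar R) mu : (1 <= q)%E -> N mu < 1 ->
  exists2 phi : int -> R[i], ell q phi &
    [/\ phi 0 = 1, forall j, 1 <= j -> phi j = 0 &
        forall j, j <= 0 -> phi (j - 1) = mu * phi j].
Proof.
move=> q1 k1; have [phi phiq phiE] := half_line_mode 1 q1 k1.
have [K phiK] := ell_bounded q1 phiq.
have phi0 j : 1 <= j -> phi j = 0.
  move=> j1; pose a n := phi (1 + n%:Z).
  have ej : 1 + `|j - 1|%N%:Z = j by lia.
  rewrite -ej -/(a _).
  apply: (geometric_unique (a := a) (M := K) k1) => n; first exact: phiK.
  rewrite /a phiE; have -> : (1 + n%:Z == 0) = false by apply/eqP; lia.
  by rewrite add0r; congr (_ * phi _); lia.
exists phi => //; split=> // [|j j0].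
  by rewrite phiE eqxx phi0// mulr0 addr0.
rewrite phiE; have -> : (j - 1 == 0) = false by apply/eqP; lia.
by rewrite add0r subrK.
Qed.

Lemma right_mode_eq0 kappa w : w 1 = 0 ->
  (forall j, 1 <= j -> w (j + 1) = kappa * w j) -> forall j, 1 <= j -> w j = 0.
Proof.
move=> w1 wE j j1; have <- : 1 + `|j - 1|%N%:Z = j by lia.
elim: `|_|%N => [|n IH]; first by rewrite addr0.
have -> : 1 + n.+1%:Z = 1 + n%:Z + 1 by lia.
by rewrite wE ?IH ?mulr0//; lia.
Qed.

Lemma left_mode_eq0 mu w : w 0 = 0 ->
  (forall j, j <= 0 -> w (j - 1) = mu * w j) -> forall j, j <= 0 -> w j = 0.
Proof.
move=> w0 wE j j0; have <- : - `|j|%N%:Z = j by lia.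
elim: `|_|%N => [|n IH]; first by rewrite oppr0.
have -> : - n.+1%:Z = - n%:Z - 1 by lia.
by rewrite wE ?IH ?mulr0//; lia.
Qed.

Lemma int_interface_cases (j : int) : [\/ 2 <= j, j <= -1, j = 0 | j = 1].
Proof.
have [?|?] := leP 2 j; first by constructor 1.
have [?|?] := leP j (-1); first by constructor 2.
by have [->|?] := eqVneq j 0; [constructor 3|constructor 4; lia].
Qed.

Lemma int_ge2_neighbours (j : int) : 2 <= j -> [/\ 1 <= j - 1, 1 <= j & 1 <= j + 1].
Proof. by move=> j2; split; lia. Qed.

Lemma int_leN1_neighbours (j : int) : j <= -1 -> [/\ j - 1 <= 0, j <= 0 & j + 1 <= 0].
Proof. by move=> j2; split; lia. Qed.

(** Cramer's rule in the unknowns [A * cl] and [B * cr]; the determinant is [1 - M ^+ 2 - P * Q] up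
    to sign. *)
Lemma interface_cramer (A B M P Q e0 e1 : R[i]) : A != 0 -> B != 0 ->
  1 - M ^+ 2 - P * Q != 0 ->
  let cl := (Q * e0 + (1 - M) * e1) / (A * (1 - M ^+ 2 - P * Q)) in
  let cr := ((1 + M) * e0 + P * e1) / (B * (1 - M ^+ 2 - P * Q)) in
  B * (1 - M) * cr - A * P * cl = e0 /\ A * (1 + M) * cl - B * Q * cr = e1.
Proof. by move=> A0 B0 D0; split; field; rewrite A0 B0 D0. Qed.

End modes.

(** * Injectivity, right inverse, and the eigenvector at 1 *)

Section resolvent.
Context {R : realType}.
Variables (q : \bar R) (q1 : (1 <= q)%E) (al ar am : R).
Hypotheses (al_gt0 : 0 < al) (al_lt1 : al < 1) (ar_lt0 : ar < 0) (ar_gtN1 : -1 < ar).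
Hypotheses (ar_am : ar <= am) (am_al : am <= al).
Implicit Types (w h : int -> R[i]) (j : int) (z : R[i]).

Let A := al%:C.
Let B := ar%:C.
Let M := am%:C.
Local Notation L := (lax_wendroff al ar am).

Let al01 : 0 < al < 1. Proof. by rewrite al_gt0. Qed.
Let ar01 : 0 < - ar < 1. Proof. by rewrite oppr_gt0 ar_lt0 ltrNl. Qed.
Let A0 : A != 0. Proof. by rewrite real_complex_neq0 gt_eqF. Qed.
Let B0 : B != 0. Proof. by rewrite real_complex_neq0 lt_eqF. Qed.
Let A1 : 1 - A != 0.
Proof. by rewrite real_complex1B real_complex_neq0 gt_eqF// subr_gt0. Qed.
Let B1 : 1 - B != 0.
Proof.
by rewrite real_complex1B real_complex_neq0 gt_eqF// subr_gt0 (lt_trans ar_lt0).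
Qed.
Let A1' : 1 + A != 0.
Proof. by rewrite real_complex1D real_complex_neq0 gt_eqF// addr_gt0. Qed.

(** The bound on [nu] is non-strict so as to cover [nu = 1], the value met at [z = 1]. *)
Lemma normc_scaled_lt1 (t : R) nu : 0 < t < 1 -> N nu <= 1 ->
  N (- ((1 - t%:C) / (1 + t%:C)) * nu) < 1.
Proof.
move=> /andP[t0 t1] nu1.
rewrite Normc.normcM normcN real_complex1B real_complex1D -fmorph_div normc_real.
have t2 : 0 <= (1 - t) / (1 + t) by apply: divr_ge0; lra.
rewrite ger0_norm//; apply: (@le_lt_trans _ _ ((1 - t) / (1 + t))).
  by rewrite ler_piMr.
by rewrite ltr_pdivrMr; lra.
Qed.

Section at_z.
Variables (z : R[i]) (nul nur : R[i]).
Hypotheses (nul0 : nul != 0) (nul1 : N nul < 1) (nur0 : nur != 0) (nur1 : N nur < 1).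
Hypothesis zl : z = 1 - A ^+ 2 + (A ^+ 2 + A) / 2 / nul + (A ^+ 2 - A) / 2 * nul.
Hypothesis zr : z = 1 - B ^+ 2 + (B ^+ 2 - B) / 2 / nur + (B ^+ 2 + B) / 2 * nur.

(* A solution decaying to the left is a multiple of mu^(-j), one decaying to
   the right a multiple of kappa^j. *)
Let mu := - ((1 - A) / (1 + A)) * nul.
Let kappa := - ((1 + B) / (1 - B)) * nur.
(** [X] equals [(1 - A) / mu] and [Y] equals [(1 + B) / kappa]. [D] is the Lopatinskii determinant
    of the interface rows 0 and 1. *)
Let X := - (1 + A) / nul.
Let Y := - (1 - B) / nur.
Let D := (1 - M ^+ 2) - (X + A - M) * (Y - B + M).

Let D0 : D != 0.
Proof.
have amP : - - ar <= am <= al by rewrite opprK ar_am.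
have det := lopatinskii_neq0 al01 ar01 amP nul0 nul1 nur0 nur1.
by rewrite rmorphN in det; exact: det.
Qed.

Let mu1 : N mu < 1. Proof. by apply: normc_scaled_lt1 => //; exact: ltW. Qed.

Let kappa1 : N kappa < 1.
Proof. by have := normc_scaled_lt1 ar01 (ltW nur1); rewrite rmorphN opprK. Qed.

Let mu0 : mu != 0.
Proof. by rewrite mulf_neq0// oppr_eq0 mulf_neq0 ?invr_eq0. Qed.

(** Boundedness reduces [w] to one decaying mode on each side, so only [w 0] and [w 1] are free;
    rows 0 and 1 form a system with determinant proportional to [D]. *)
Lemma lax_wendroff_inj w : ell q w -> L w = (fun j => z * w j) -> w = fun=> 0.
Proof.
move=> wq Lw; have [K wK] := ell_bounded q1 wq.
have {}Lw j : L w j = z * w j by rewrite Lw.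
have right : forall j, 1 <= j -> w (j + 1) = kappa * w j.
  apply: (bounded_recurrence_right nur0 nur1 wK) => j j2.
  have := Lw j; rewrite lax_wendroff_ge2// -/B zr => e.
  move/eqP: e; rewrite -subr_eq0 => /eqP e.
  (* This factor normalizes the coefficient of [w (j + 1)] to [nur], as required by
     [bounded_recurrence_right]. *)
  rewrite -[RHS](mulr0 (2 * nur / (B ^+ 2 - B))) -e /kappa.
  have BB : B ^+ 2 - B != 0.
    by rewrite (_ : _ - _ = - (B * (1 - B))) ?oppr_eq0 ?mulf_neq0//; ring.
  field; rewrite nur0 B1 BB//.
have left : forall j, j <= 0 -> w (j - 1) = mu * w j.
  apply: (bounded_recurrence_left nul0 nul1 wK) => j j1.
  have := Lw j; rewrite lax_wendroff_leN1// -/A zl => e.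
  move/eqP: e; rewrite -subr_eq0 => /eqP e.
  rewrite -[RHS](mulr0 (2 * nul / (A ^+ 2 + A))) -e /mu.
  have AA : A ^+ 2 + A != 0.
    by rewrite (_ : _ + _ = A * (1 + A)) ?mulf_neq0//; ring.
  field; rewrite nul0 A1' AA//.
(* Row 0, with [w (-1)] eliminated by the left mode and [z] by [zl]; row 1 is treated likewise with
   [w 2] and [zr]. *)
have e0 : B * (1 - M) * w 1 = A * (X + A - M) * w 0.
  have := Lw 0; rewrite lax_wendroff_0 -/A -/B -/M.
  have -> : w (- 1) = mu * w 0 by rewrite -left.
  rewrite zl => e; apply: subr0_eq.
  move/eqP: e; rewrite -subr_eq0 => /eqP e.
  rewrite -[RHS](mulr0 (- 2)) -e /mu /X; field; rewrite nul0 A1'//.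
have e1 : A * (1 + M) * w 0 = B * (Y - B + M) * w 1.
  have := Lw 1; rewrite lax_wendroff_1 -/A -/B -/M.
  have -> : w 2 = kappa * w 1 by rewrite -right.
  rewrite zr => e; apply: subr0_eq.
  move/eqP: e; rewrite -subr_eq0 => /eqP e.
  rewrite -[RHS](mulr0 2) -e /kappa /Y; field; rewrite nur0 B1//.
have w0 : w 0 = 0.
  have e : A * D * w 0 = 0.
    have -> : A * D * w 0 = (1 - M) * (A * (1 + M) * w 0) -
        (Y - B + M) * (A * (X + A - M) * w 0) by rewrite /D; ring.
    by rewrite e1 -e0; ring.
  by move/eqP: e; rewrite !mulf_eq0 (negPf A0) (negPf D0) => /eqP.
have w1 : w 1 = 0.
  have e : B * D * w 1 = 0.
    have -> : B * D * w 1 = (1 + M) * (B * (1 - M) * w 1) -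
        (X + A - M) * (B * (Y - B + M) * w 1) by rewrite /D; ring.
    by rewrite e0 -e1; ring.
  by move/eqP: e; rewrite !mulf_eq0 (negPf B0) (negPf D0) => /eqP.
apply/funext => j; have [j0|j1] := leP j 0.
  exact: (left_mode_eq0 w0 left).
by apply: (right_mode_eq0 w1 right); rewrite -gtz0_ge1.
Qed.

(** Away from the interface the modes solve the homogeneous equation, so only rows 0 and 1 constrain
    [cl] and [cr]. The one-sided equations at [j = 0] and [j = 1] are subtracted from these rows,
    which cancels [h]. This serves for the resolvent and, with [h = 0], for the eigenvector. *)
Lemma lax_wendroff_glue (h wl wr phil phir : int -> R[i]) (cl cr : R[i]) w :
  (forall j, j <= 0 -> (A - A ^+ 2) / 2 * (wl (j + 1) - (nul + mu^-1) * wl j +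
     nul * mu^-1 * wl (j - 1)) = h j) ->
  (forall j, 1 <= j -> (B - B ^+ 2) / 2 * (wr (j + 1) - (kappa + nur^-1) * wr j +
     kappa * nur^-1 * wr (j - 1)) = h j) ->
  phil 0 = 1 -> (forall j, j <= 0 -> phil (j - 1) = mu * phil j) ->
  phir 1 = 1 -> (forall j, 1 <= j -> phir (j + 1) = kappa * phir j) ->
  (forall j, j <= 0 -> w j = wl j + cl * phil j) ->
  (forall j, 1 <= j -> w j = wr j + cr * phir j) ->
  B * (1 - M) * cr - A * (X + A - M) * cl =
    A * ((1 - A) * wl 1 + (A - M) * wl 0) - B * (1 - M) * wr 1 ->
  A * (1 + M) * cl - B * (Y - B + M) * cr =
    B * ((1 + B) * wr 0 + (M - B) * wr 1) - A * (1 + M) * wl 0 ->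
  forall j, z * w j - L w j = h j.
Proof.
move=> wlE wrE phil0 philE phir1 phirE wL wR E0 E1 j.
case: (int_interface_cases j) => [j2|j1|->|->].
- have [i1 i2 i3] := int_ge2_neighbours j2.
  rewrite lax_wendroff_ge2// -/B (wR _ i1) (wR _ i2) (wR _ i3) -(wrE _ i2).
  have phij : phir j = kappa * phir (j - 1) by rewrite -(phirE _ i1) subrK.
  rewrite (phirE _ i2) phij zr /kappa.
  field; rewrite nur0 B1//.
- have [i1 i2 i3] := int_leN1_neighbours j1.
  rewrite lax_wendroff_leN1// -/A (wL _ i1) (wL _ i2) (wL _ i3) -(wlE _ i2).
  have phij : phil j = mu * phil (j + 1) by rewrite -(philE _ i3) addrK.
  rewrite (philE _ i2) phij zl /mu.
  field; rewrite nul0 A1 A1'//.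
- rewrite lax_wendroff_0 -/A -/B -/M -wlE// (wL 0)// (wL (-1))// (wR 1)//.
  rewrite phil0 phir1 (_ : phil (-1) = mu); last first.
    by rewrite -[-1]sub0r philE// phil0 mulr1.
  have e : 2^-1 * (B * (1 - M) * cr - A * (X + A - M) * cl -
     (A * ((1 - A) * wl 1 + (A - M) * wl 0) - B * (1 - M) * wr 1)) = 0.
    by rewrite E0 subrr mulr0.
  apply: subr0_eq; rewrite -[RHS]e add0r sub0r zl /mu /X.
  field; rewrite nul0 A1 A1'//.
- rewrite lax_wendroff_1 -/A -/B -/M -wrE// (wR 1)// (wL 0)// (wR 2)//.
  rewrite phil0 phir1 (_ : phir 2 = kappa); last first.
    by rewrite -[2]/(1 + 1) phirE// phir1 mulr1.
  have e : 2^-1 * (A * (1 + M) * cl - B * (Y - B + M) * cr -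
     (B * ((1 + B) * wr 0 + (M - B) * wr 1) - A * (1 + M) * wl 0)) = 0.
    by rewrite E1 subrr mulr0.
  apply: subr0_eq; rewrite -[RHS]oppr0 -[in RHS]e subrr -[1 + 1]/2 zr /kappa /Y.
  field; rewrite nur0 B1//.
Qed.

Lemma lax_wendroff_right_inverse :
  exists2 S : (int -> R[i]) -> (int -> R[i]), bounded_operator q S &
    forall h, ell q h -> forall j, z * S h j - L (S h) j = h j.
Proof.
have a0 : (A - A ^+ 2) / 2 != 0.
  rewrite (_ : A - A ^+ 2 = A * (1 - A)); last ring.
  by rewrite !mulf_neq0 ?invr_eq0 ?pnatr_eq0.
have b0 : (B - B ^+ 2) / 2 != 0.
  rewrite (_ : B - B ^+ 2 = B * (1 - B)); last ring.
  by rewrite !mulf_neq0 ?invr_eq0 ?pnatr_eq0.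
have inv_gt1 (x : R[i]) : x != 0 -> N x < 1 -> 1 < N x^-1.
  move=> x0 x1; rewrite Normc.normcV invf_gt1// lt_def normc_ge0 andbT.
  by apply: contra x0 => /eqP/Normc.eq0_normc ->.
(* The small and large roots are [nul] and [mu^-1] on the left, [kappa] and [nur^-1] on the
   right. *)
have [Sl bSl SlE] := recurrence_operator q1 a0 nul1 (inv_gt1 _ mu0 mu1).
have [Sr bSr SrE] := recurrence_operator q1 b0 kappa1 (inv_gt1 _ nur0 nur1).
have [phil philq [phil0 phil_eq0 philE]] := left_mode q1 mu1.
have [phir phirq [phir1 phir_eq0 phirE]] := right_mode q1 kappa1.
(* At [j = 0], [e0] and [e1] are the right-hand sides of the interface system. Letting [j] vary
   makes them bounded operators by the closure lemmas; [bounded_operator_rank1] then evaluates the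
   Cramer coefficients [Cl] and [Cr] at 0. *)
pose e0 h j := A * ((1 - A) * Sl h (j + 1) + (A - M) * Sl h j) +
  - B * (1 - M) * Sr h (j + 1).
pose e1 h j := B * ((1 + B) * Sr h j + (M - B) * Sr h (j + 1)) +
  - A * (1 + M) * Sl h j.
have bS1 T : bounded_operator q T -> bounded_operator q (fun h j => T h (j + 1)).
  by move=> bT; exact: (bounded_operator_comp (bounded_operator_shift q1 1) bT).
have be0 : bounded_operator q e0.
  apply: bounded_operatorD => //; apply: bounded_operatorZ => //; last exact: bS1.
  by apply: bounded_operatorD => //; apply: bounded_operatorZ => //; exact: bS1.
have be1 : bounded_operator q e1.
  apply: bounded_operatorD => //; apply: bounded_operatorZ => //.
  by apply: bounded_operatorD => //; apply: bounded_operatorZ => //; exact: bS1.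
pose P := X + A - M; pose Q := Y - B + M.
pose Cl h j := (A * D)^-1 * (Q * e0 h j + (1 - M) * e1 h j).
pose Cr h j := (B * D)^-1 * ((1 + M) * e0 h j + P * e1 h j).
have bCl : bounded_operator q Cl.
  apply: bounded_operatorZ => //.
  by apply: bounded_operatorD => //; apply: bounded_operatorZ.
have bCr : bounded_operator q Cr.
  apply: bounded_operatorZ => //.
  by apply: bounded_operatorD => //; apply: bounded_operatorZ.
pose S h j := (if j <= 0 then Sl h j else Sr h j) + (Cl h 0 * phil j + Cr h 0 * phir j).
exists S.
  apply: bounded_operatorD => //.
    exact: (@bounded_operator_glue _ _ q1 (fun j => j <= 0)).
  by apply: bounded_operatorD => //; exact: bounded_operator_rank1.
move=> h hq; have [E0 E1] := interface_cramer (e0 h 0) (e1 h 0) A0 B0 D0.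
have ClE : Cl h 0 = (Q * e0 h 0 + (1 - M) * e1 h 0) / (A * D) by rewrite /Cl mulrC.
have CrE : Cr h 0 = ((1 + M) * e0 h 0 + P * e1 h 0) / (B * D) by rewrite /Cr mulrC.
apply: (@lax_wendroff_glue h (Sl h) (Sr h) phil phir (Cl h 0) (Cr h 0)) => //.
- move=> j _; rewrite -[RHS](SlE _ hq); ring.
- move=> j _; rewrite -[RHS](SrE _ hq); ring.
- by move=> j j0; rewrite /S j0 (phir_eq0 _ j0) mulr0 addr0.
- move=> j j1; have j0 : (j <= 0) = false by apply/negbTE; rewrite -ltNge gtz0_ge1.
  by rewrite /S j0 (phil_eq0 _ j1) mulr0 add0r.
- by rewrite ClE CrE [LHS]E0 /e0 add0r; ring.
- by rewrite ClE CrE [LHS]E1 /e1 add0r; ring.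
Qed.

Lemma lax_wendroff_resolvent : resolvent_set q L z.
Proof.
have [S bS SE] := lax_wendroff_right_inverse.
exists S => // w wq.
have bL : bounded_operator q L by exact: lax_wendroff_bounded.
have Lwq := bounded_operator_ell bL wq.
pose r j := z * w j - L w j.
have rq : ell q r.
  rewrite (_ : r = fun j => z * w j + (-1) * L w j).
    by apply: ellD => //; exact: ellZ.
  by apply/funext => j; rewrite /r; ring.
split; last by apply/funext => j; rewrite SE.
have Srq := bounded_operator_ell bS rq.
(* A right inverse of an injective operator is a left inverse: [S r - w] lies in the kernel of
   [z - L]. It is written in the form of the linearity clause of [bounded_operator]. *)
have v0 : (fun j => (-1) * w j + S r j) = fun=> 0.
  apply: lax_wendroff_inj; first by apply: ellD => //; exact: ellZ.
  rewrite bL.1//; apply/funext => j; apply: subr0_eq.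
  rewrite -[RHS](subrr (r j)) -{2}(SE _ rq j) /r; ring.
apply/funext => j; rewrite -/r; apply: subr0_eq.
by rewrite -[RHS](congr1 (fun f => f j) v0) /=; ring.
Qed.

End at_z.

(** At [z = 1] both characteristic equations hold with [nu = 1], so [X + A - M = - (1 + M)] and
    [Y - B + M = - (1 - M)], and [D] vanishes. The pair [cl = B * (1 - M)], [cr = - A * (1 + M)]
    spans the kernel, with [cl] nonzero because [am <= al < 1]. *)
Lemma lax_wendroff_eigenvalue1 : eigenvalue_in q L 1.
Proof.
have N1 : N (1 : R[i]) <= 1 by rewrite Normc.normc1.
have mu1 := normc_scaled_lt1 al01 N1.
have := normc_scaled_lt1 ar01 N1; rewrite rmorphN opprK => kappa1.
have [phil philq [phil0 phil_eq0 philE]] := left_mode q1 mu1.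
have [phir phirq [phir1 phir_eq0 phirE]] := right_mode q1 kappa1.
pose w j := B * (1 - M) * phil j + - (A * (1 + M)) * phir j.
have M1 : 1 - M != 0.
  by rewrite real_complex1B real_complex_neq0 gt_eqF// subr_gt0 (le_lt_trans am_al).
exists w; split.
- by apply: ellD => //; exact: ellZ.
- move=> /(congr1 (fun f => f 0)); rewrite /w phil0 phir_eq0// mulr0 addr0 mulr1.
  by move/eqP; rewrite mulf_eq0 (negPf B0) (negPf M1).
have zl : 1 = 1 - A ^+ 2 + (A ^+ 2 + A) / 2 / 1 + (A ^+ 2 - A) / 2 * 1 by field.
have zr : 1 = 1 - B ^+ 2 + (B ^+ 2 - B) / 2 / 1 + (B ^+ 2 + B) / 2 * 1 by field.
have glue := @lax_wendroff_glue 1 1 1 (oner_neq0 _) (oner_neq0 _) zl zr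
  (fun=> 0) (fun=> 0) (fun=> 0) phil phir (B * (1 - M)) (- (A * (1 + M))) w.
apply/funext => j; apply/esym/subr0_eq; apply: glue => //.
- by move=> i _; ring.
- by move=> i _; ring.
- by move=> i i0; rewrite /w (phir_eq0 _ i0); ring.
- by move=> i i1; rewrite /w (phil_eq0 _ i1); ring.
- by field.
- by field.
Qed.

End resolvent.

(** * Convexity of the flux *)

Section convexity.
Context {R : realType}.
Implicit Types (f : R -> R).

(** Convexity bounds the difference quotients along [y - x], for steps in []0, 1]], by [f y - f x];
    the bound passes to the limit from the right. *)
Lemma convex_tangent f (x y : R) : derivable f x 1 ->
  convex_function [set: R] f -> derive1 f x * (y - x) <= f y - f x.
Proof.
move=> df cf; have dx : differentiable f x by exact/derivable1_diffP.
have -> : derive1 f x * (y - x) = 'D_(y - x) f x.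
  rewrite derive1E'// deriveE//.
  have {2}-> : y - x = (y - x) *: (1 : R) by rewrite /GRing.scale /= mulr1.
  by rewrite linearZ /= mulrC.
have dyx : derivable f x (y - x) by exact: diff_derivable.
have cv := cvg_dnbhs_at_right dyx.
rewrite /derive -(cvg_lim (@Rhausdorff R) cv) //.
apply: limr_le; first by apply/cvg_ex; eexists; exact: cv.
near=> t.
have t0 : 0 < t by near: t; exact: nbhs_right_gt.
have t1 : t <= 1 by near: t; exact: nbhs_right_le.
have := cf (Itv01 (ltW t0) t1) y x; rewrite !inE => /(_ Logic.I Logic.I).
rewrite convRE /= /unstable.onem /GRing.scale /= => ft.
rewrite ler_pdivrMl// lerBlDr.
have -> : t * (y - x) + x = t * y + (1 - t) * x by ring.
apply: (le_trans ft); rewrite le_eqVlt; apply/orP; left; apply/eqP; ring.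
Unshelve. all: by end_near. Qed.

(** The tangent inequalities at [x] and at [y] enclose [f y - f x]. *)
Lemma convex_derive1_mono f (x y : R) : (forall t, derivable f t 1) ->
  convex_function [set: R] f -> x <= y -> derive1 f x <= derive1 f y.
Proof.
move=> df cf; rewrite le_eqVlt => /orP[/eqP->//|xy].
have H1 := convex_tangent y (df x) cf; have H2 := convex_tangent x (df y) cf.
rewrite -(@ler_pM2r _ (y - x)) ?subr_gt0//.
apply: (le_trans H1); rewrite -lerN2 opprB; apply: le_trans H2.
by rewrite -mulrN opprB.
Qed.

(** Monotonicity of the derivative forces [ur < ul], so the midpoint lies between them. *)
Lemma convex_derive1_midpoint f (ul ur : R) : (forall t, derivable f t 1) ->
  convex_function [set: R] f -> derive1 f ur < derive1 f ul ->
  derive1 f ur <= derive1 f ((ul + ur) / 2) <= derive1 f ul.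
Proof.
move=> df cf lt; have [le|lt'] := leP ul ur.
  by have := convex_derive1_mono df cf le; rewrite leNgt lt.
by apply/andP; split; apply: convex_derive1_mono => //; lra.
Qed.

End convexity.


Theorem theorem2p2 (R : realType) (f : R -> R) (ul ur lam : R)
    (f_smooth : smooth f)
    (f_cvx_or_ccv : convex_function [set: R] f \/
                    convex_function [set: R] (fun x => - f x))
    (lam_gt0 : 0 < lam)
    (rankine_hugoniot : f ul = f ur)
    (entropy : derive1 f ur < 0 < derive1 f ul) :
  let al := lam * derive1 f ul in
  let ar := lam * derive1 f ur in
  let am := lam * derive1 f ((ul + ur) / 2) in
  Num.max al `|ar| < 1 ->
  forall q : \bar R, (1 <= q)%E ->
    spectrum q (lax_wendroff al ar am)
      `&` ([set z : R[i] | 1 <= `|z|] `\ (1 : R[i])) = set0 /\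
    eigenvalue_in q (lax_wendroff al ar am) 1.
Proof.
move=> al ar am; rewrite gt_max => /andP[al_lt1 ar_lt1] q q1.
have /andP[dur dul] := entropy.
have df t : derivable f t 1 by exact: (f_smooth 0%N).
have /andP[mr ml] : derive1 f ur <= derive1 f ((ul + ur) / 2) <= derive1 f ul.
  case: f_cvx_or_ccv => cf.
    by apply: convex_derive1_midpoint => //; exact: lt_trans dul.
  (* In the concave case, the convex result is applied to [- f] with [ul] and [ur] exchanged. *)
  have dN t : derive1 (fun x => - f x) t = - derive1 f t by exact: derive1N.
  have := @convex_derive1_midpoint _ (fun x => - f x) ur ul _ cf _.
  rewrite !dN !lerN2 ltrN2 addrC andbC; apply; last exact: lt_trans dul.
  by move=> t; exact: derivableN.
have al_gt0 : 0 < al by rewrite mulr_gt0.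
have ar_lt0 : ar < 0 by rewrite pmulr_rlt0.
have ar_gtN1 : -1 < ar by move: ar_lt1; rewrite ltr_norml => /andP[].
have ar_am : ar <= am by rewrite ler_pM2l.
have am_al : am <= al by rewrite ler_pM2l.
split; last exact: lax_wendroff_eigenvalue1.
apply/seteqP; split => // z [zspec [z1 zN1]]; apply: zspec.
have {}z1 : 1 <= N z by rewrite -lecR.
have {}zN1 : z != 1 by apply/eqP.
have al01 : 0 < al < 1 by rewrite al_gt0.
have ar01 : 0 < - ar < 1 by rewrite oppr_gt0 ar_lt0 ltrNl.
have [nul [nul0 nul1 zl]] := lax_wendroff_root al01 z1 zN1.
(* Changing [ar] to [- ar] inverts the characteristic roots, so [nur] is the inverse of a root on
   the right. *)
have [nur [nur0 nur1 zr]] := lax_wendroff_root ar01 z1 zN1.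
apply: (lax_wendroff_resolvent q1 _ _ _ _ _ _ nul0 nul1 nur0 nur1) => //.
by rewrite zr rmorphN; ring.
Qed.
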